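(* Let $G$ be a graph and $\theta$ a real number with $\mathrm{mult}(\theta,G)\ge2$. Let $H_1,\dots,H_q$ be the components of $G\setminus A_\theta(G)$ that are $\theta$-critical and $Q_1,\dots,Q_m$ those with $\mathrm{mult}(\theta,Q_j)=0$. For distinct vertices $u,v$, $\mathrm{mult}(\theta,S_\theta(G)\setminus\{u,v\})=\mathrm{mult}(\theta,S_\theta(G))$ if and only if one of the following holds: (a) one of $u,v$ lies in $P_\theta(G)\cup A_\theta(G)$ and the other in $B_\theta(G)$; (b) $u,v\in N_\theta(G)$ with $u\in V(Q_{j_1})$, $v\in V(Q_{j_2})$ for some $j_1\neq j_2$; (c) $u,v\in V(H_{i_0})$ for some $i_0$ and $\mathrm{mult}(\theta,H_{i_0}\setminus\{u,v\})=1$; (d) $u,v\in V(Q_{j_0})$ for some $j_0$ and $\mathrm{mult}(\theta,Q_{j_0}\setminus\{u,v\})=0$.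
   Context: All graphs are finite and simple. For a graph $G$ on $n$ vertices, let $p(G,r)$ be the number of $r$-matchings of $G$ ($p(G,0)=1$); the matching polynomial is $\mu(G,x)=\sum_{r=0}^{\lfloor n/2\rfloor}(-1)^r p(G,r)x^{n-2r}$. For real $\theta$, $\mathrm{mult}(\theta,G)$ is the multiplicity of $\theta$ as a root of $\mu(G,x)$ (it is $0$ if $\theta$ is not a root). $G\setminus X$ denotes deletion of the vertex set $X$; $G\setminus u=G\setminus\{u\}$. A vertex $u$ is $\theta$-essential, $\theta$-neutral, or $\theta$-positive in $G$ according as $\mathrm{mult}(\theta,G\setminus u)$ equals $\mathrm{mult}(\theta,G)-1$, $\mathrm{mult}(\theta,G)$, or $\mathrm{mult}(\theta,G)+1$. A vertex is $\theta$-special if it is not $\theta$-essential but is adjacent to a $\theta$-essential vertex. $B_\theta(G)$, $A_\theta(G)$, $N_\theta(G)$ are the sets of $\theta$-essential, $\theta$-special, $\theta$-neutral vertices, and $P_\theta(G)$ the set of $\theta$-positive vertices that are not $\theta$-special. A connected graph is $\theta$-critical if all its vertices are $\theta$-essential in it; every component of $G\setminus A_\theta(G)$ is either $\theta$-critical or has $\mathrm{mult}(\theta,\cdot)=0$. $S_\theta(G)$ is the graph on $V(G)$ whose edges are the edges of $G$ together with all pairs $\{w,z\}$, $z\neq w$, with $w\in A_\theta(G)$. *)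

(* Defs.v *)
From HB Require Import structures.
From mathcomp Require Import all_boot all_order all_algebra.
Set Implicit Arguments. Unset Strict Implicit. Unset Printing Implicit Defensive.
Import Order.TTheory GRing.Theory Num.Theory.

(* A graph is given by a finite vertex type T and an adjacency relation
   e : rel T (assumed symmetric and irreflexive in the theorem).  Induced
   subgraphs are given by a vertex set S : {set T}; G \ X is the induced
   subgraph on S :\: X. *)

Section MatchingDefs.
Variable T : finType.
Implicit Types (e : rel T) (S : {set T}).

Definition is_matching e S (M : {set {set T}}) : bool :=
  [forall m in M, exists x, exists y,
     [&& x != y, e x y, x \in S, y \in S & m == [set x; y]]]
  && trivIset M.

Definition nmatch e S (r : nat) : nat :=
  #|[set M : {set {set T}} | is_matching e S M & #|M| == r]|.

Local Open Scope ring_scope.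

Definition match_poly (R : ringType) e S : {poly R} :=
  \sum_(r < (#|S|./2).+1)
     (((-1) ^+ r * (nmatch e S r)%:R) *: 'X^(#|S| - r.*2)%N).

Definition mult (R : fieldType) (theta : R) e S : nat :=
  mup theta (match_poly R e S).

Definition essential (R : fieldType) (theta : R) e S u : bool :=
  (u \in S) && ((mult theta e (S :\ u)).+1 == mult theta e S).
Definition neutral (R : fieldType) (theta : R) e S u : bool :=
  (u \in S) && (mult theta e (S :\ u) == mult theta e S).
Definition positive (R : fieldType) (theta : R) e S u : bool :=
  (u \in S) && (mult theta e (S :\ u) == (mult theta e S).+1).

Definition Bset (R : fieldType) (theta : R) e S : {set T} :=
  [set u in S | essential theta e S u].
Definition Aset (R : fieldType) (theta : R) e S : {set T} :=
  [set u in S | ~~ essential theta e S u &&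
                [exists w in Bset theta e S, e u w]].
Definition Nset (R : fieldType) (theta : R) e S : {set T} :=
  [set u in S | neutral theta e S u].
Definition Pset (R : fieldType) (theta : R) e S : {set T} :=
  [set u in S | positive theta e S u && (u \notin Aset theta e S)].

Definition Srel (R : fieldType) (theta : R) e S : rel T :=
  fun x y => e x y || ((x != y) && ((x \in Aset theta e S) || (y \in Aset theta e S))).

Definition restr e S : rel T := fun x y => [&& x \in S, y \in S & e x y].

Definition component e S x : {set T} := [set y in S | connect (restr e S) x y].

Definition is_component e S (C : {set T}) : bool :=
  [exists x in S, C == component e S x].

Definition critical (R : fieldType) (theta : R) e (C : {set T}) : bool :=
  [&& C != set0,
      [forall x in C, forall y in C, connect (restr e C) x y] &
      [forall x in C, essential theta e C x]].

End MatchingDefs.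

(* Main.v *)
(* Write mu(S) for the matching polynomial of the subgraph induced on S and
   call mult S the order of mu(S) at theta.  Everything rests on the recursion
   mu(S) = X mu(S\u) - sum_(v ~ u) mu(S\u\v), which by iteration along paths
   turns mu'(S) mu(S\u) - mu(S) mu'(S\u) and mu(S\u) mu(S\v) - mu(S) mu(S\u\v)
   into sums of squares.  Near theta sums of squares have even order, positive
   leading coefficient, and no cancellation; this gives interlacing, the fact
   that a vertex w is positive in S iff it is adjacent to a vertex essential in
   S\w, and, through a three-vertex variant of the identity, a transitivity
   property of essential vertices.  Transitivity yields the stability lemma
   mult(S\y\u) = mult(S\u) + 1 for y special, and stability yields Gallai's
   lemma.  Hence deleting A from G raises the multiplicity by #|A|, preserves
   the type of every other vertex, and leaves components that are critical of
   multiplicity 1 or have multiplicity 0.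

   In S_theta(G) every vertex of A is universal, and adding a universal vertex
   to a graph with positive multiplicity lowers it by one.  As mult G >= 2, the
   multiplicity of G \ A \ {u, v} is at least #|A|, so that of
   S_theta(G) \ {u, v} is the multiplicity of G \ A \ {u, v} minus
   #|A \ {u, v}|; the theorem is then a count over the components. *)

Require Import Defs.
From mathcomp Require Import all_boot all_order all_algebra.
From mathcomp Require Import zify ring.
Set Implicit Arguments. Unset Strict Implicit. Unset Printing Implicit Defensive.
Import Order.TTheory GRing.Theory Num.Theory.
Local Open Scope ring_scope.

(** * The vertex recursion for matching polynomials *)

Section MatchingRecursion.
Variables (R : comNzRingType) (T : finType) (e : rel T).
Hypotheses (e_sym : symmetric e) (e_irr : irreflexive e).
Implicit Types (S : {set T}) (M : {set {set T}}).

Lemma is_matchingP S M :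
  reflect ((forall m, m \in M ->
              exists x y, [/\ e x y, x \in S, y \in S & m = [set x; y]])
           /\ trivIset M)
          (is_matching e S M).
Proof.
apply: (iffP andP) => -[edges triv]; split=> //.
  move=> m mM; move/forall_inP: edges => /(_ m mM) /existsP[x /existsP[y]].
  by case/and5P=> _ exy xS yS /eqP->; exists x, y.
apply/forall_inP=> m /edges[x [y [exy xS yS ->]]].
apply/existsP; exists x; apply/existsP; exists y; rewrite exy xS yS eqxx !andbT.
by apply: contraTneq exy => ->; rewrite e_irr.
Qed.

Lemma matching_cover S M : is_matching e S M -> cover M \subset S.
Proof.
case/is_matchingP=> edges _; apply/bigcupsP=> m /edges[x [y [_ xS yS ->]]].
by apply/subsetP=> z; rewrite !inE => /orP[] /eqP->.
Qed.

Lemma matching_card S M : is_matching e S M -> (#|M|.*2 <= #|S|)%N.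
Proof.
move=> mM; apply: leq_trans (subset_leq_card (matching_cover mM)).
case/is_matchingP: mM => edges /eqP <-.
rewrite (eq_bigr (fun=> 2%N)) ?sum_nat_const ?muln2 // => m /edges.
case=> x [y [exy _ _ ->]]; rewrite cards2; case: eqP exy => // ->.
by rewrite e_irr.
Qed.

(** By [matching_card] the bound on [r] loses no matching; as a signed sum over the matchings
    themselves the polynomial is ready for a bijective proof of the recursion. *)
Lemma match_poly_sumE S :
  match_poly R e S =
  \sum_(M | is_matching e S M) (-1) ^+ #|M| *: 'X^(#|S| - #|M|.*2).
Proof.
rewrite /match_poly [RHS](partition_big
  (fun M => inord #|M| : 'I_(#|S|./2).+1) xpredT) //=.
apply: eq_bigr => r _.
rewrite [RHS](eq_bigr (fun=> (-1) ^+ r *: 'X^(#|S| - r.*2))).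
  rewrite sumr_const scalerMnl mulr_natr; congr (_ *+ _ *: _).
  rewrite /nmatch; apply: eq_card => M; rewrite !inE unfold_in /=.
  case mM: (is_matching e S M) => //=; rewrite -val_eqE /= inordK //.
  by rewrite ltnS -(doubleK #|M|) half_leq // matching_card.
move=> M /andP[mM /eqP <-]; rewrite inordK //.
by rewrite ltnS -(doubleK #|M|) half_leq // matching_card.
Qed.

Lemma match_poly0 : match_poly R e set0 = 1.
Proof.
rewrite /match_poly cards0 big_ord_recl big_ord0 /= addr0 mul1r expr0.
suff ->: nmatch e set0 0 = 1%N by rewrite scale1r.
rewrite /nmatch -(cards1 (set0 : {set {set T}})); apply: eq_card => M.
rewrite !inE cards_eq0 andb_idl // => /eqP->.
apply/is_matchingP; split=> [m|]; first by rewrite inE.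
by apply/trivIsetP=> A B; rewrite inE.
Qed.

Lemma matching_avoid S M u :
  is_matching e S M && (u \notin cover M) = is_matching e (S :\ u) M.
Proof.
apply/idP/idP=> [/andP[/is_matchingP[edges triv] uM]|mM].
  apply/is_matchingP; split=> // m mM; have [x [y [exy xS yS mE]]] := edges m mM.
  exists x, y; rewrite !inE xS yS exy mE !andbT; split=> //.
    by apply: contraNneq uM => <-; apply/bigcupP; exists m; rewrite // mE set21.
  by apply: contraNneq uM => <-; apply/bigcupP; exists m; rewrite // mE set22.
apply/andP; split; last first.
  by apply: contraTN (matching_cover mM) => uM; apply/subsetPn; exists u; rewrite // !inE eqxx.
have [edges triv] := is_matchingP _ _ mM; apply/is_matchingP; split=> // m /edges.
by case=> x [y [exy /setD1P[_ xS] /setD1P[_ yS] ->]]; exists x, y.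
Qed.

Lemma matching_unique S M u v w : is_matching e S M ->
  [set u; v] \in M -> [set u; w] \in M -> v = w.
Proof.
case/is_matchingP=> edges /trivIsetP triv uvM uwM.
have E: [set u; v] = [set u; w].
  apply/eqP; apply: contraT => /(triv _ _ uvM uwM) /pred0P/(_ u).
  by rewrite /= !inE eqxx.
have nuv: u != v.
  have [x [y [exy _ _ D]]] := edges _ uvM.
  apply: contraTneq exy => uv; move: D; rewrite uv setUid => D.
  have: x \in [set v] by rewrite D set21.
  have: y \in [set v] by rewrite D set22.
  by rewrite !inE => /eqP-> /eqP->; rewrite e_irr.
by have := set22 u v; rewrite E !inE eq_sym (negPf nuv) => /eqP.
Qed.

(** The second conjunct on the left says that the edge is not already in [M]; it has the form of the
    side condition that [reindex_onto] produces. *)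
Lemma matching_extend S M u v : u \in S -> v \in S -> e u v ->
  (is_matching e S ([set u; v] |: M) && (([set u; v] |: M) :\ [set u; v] == M))
  = is_matching e (S :\ u :\ v) M.
Proof.
move=> uS vS euv; rewrite -!matching_avoid.
apply/idP/idP=> [/andP[/is_matchingP[edges triv] /eqP DM]|].
  have disj m : m \in M -> [disjoint m & [set u; v]].
    rewrite -{1}DM => /setD1P[nm mM]; move/trivIsetP: triv; apply=> //.
    exact: setU11.
  have avoid x : x \in [set u; v] -> x \notin cover M.
    move=> xuv; apply/negP=> /bigcupP[m /disj/pred0P/(_ x)] /=.
    by rewrite xuv andbT => ->.
  rewrite !avoid ?set21 ?set22 // !andbT; apply/is_matchingP; split.
    by move=> m mM; apply: edges; rewrite inE mM orbT.
  by apply: trivIsetS triv; apply: subsetUr.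
case/andP=> /andP[/is_matchingP[edges triv] uM] vM.
have uvM: [set u; v] \notin M.
  by apply: contra uM => uvM; apply/bigcupP; exists [set u; v]; rewrite ?set21.
rewrite setU1K // eqxx andbT; apply/is_matchingP; split.
  move=> m /setU1P[->|/edges//]; by exists u, v.
have disj m : m \in M -> [disjoint [set u; v] & m].
  move=> mM; apply/pred0P=> x /=; rewrite !inE; apply/negP=> /andP[].
  case/orP=> /eqP-> xm; [move: uM|move: vM]; apply/negP; rewrite negbK.
    by apply/bigcupP; exists m.
  by apply/bigcupP; exists m.
apply/trivIsetP=> A B /setU1P[->|AM] /setU1P[->|BM]; rewrite ?eqxx //.
- by move=> _; apply: disj.
- by move=> _; rewrite disjoint_sym; apply: disj.
by move=> nAB; move/trivIsetP: triv; apply.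
Qed.

(** Matchings that miss [u] give the first term. The others are sorted by the partner [v] of [u];
    removing the edge [uv] lowers the size by one, whence the minus sign. *)
Lemma match_poly_rec S u : u \in S ->
  match_poly R e S = 'X * match_poly R e (S :\ u)
    - \sum_(v in S :\ u | e u v) match_poly R e (S :\ u :\ v).
Proof.
move=> uS; rewrite !match_poly_sumE (bigID (fun M => u \notin cover M)) /=.
have cS : #|S| = #|S :\ u|.+1 by rewrite (cardsD1 u) uS.
congr (_ + _).
  rewrite (eq_bigl _ _ (fun M => matching_avoid S M u)) mulr_sumr.
  apply: eq_bigr => M mM; rewrite -scalerAr -exprS cS subSn //.
  exact: matching_card mM.
(* The default [u] is harmless: only matchings that cover [u] are sorted by [mate]. *)
pose mate M := odflt u [pick v | [set u; v] \in M].
have mateP M : is_matching e S M -> u \in cover M -> [set u; mate M] \in M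
    /\ (mate M \in S :\ u) && e u (mate M).
  move=> mM /bigcupP[m mM' um].
  have [x [y [exy xS yS mE]]] := (is_matchingP _ _ mM).1 m mM'.
  have [w [euw wS mEw]] : exists w, [/\ e u w, w \in S & m = [set u; w]].
    move: um; rewrite mE !inE => /orP[]/eqP->; first by exists y.
    by exists x; rewrite e_sym setUC.
  rewrite /mate; case: pickP => [v /= uvM|/(_ w)]; last by rewrite /= -mEw mM'.
  have -> : v = w by apply: matching_unique mM _ _; [exact: uvM | rewrite -mEw].
  rewrite -mEw euw !inE wS !andbT; split=> //.
  by apply: contraTneq euw => ->; rewrite e_irr.
rewrite (partition_big mate (fun v => (v \in S :\ u) && e u v)) /=; last first.
  by move=> M /andP[mM]; rewrite negbK => uM; case: (mateP M mM uM).
rewrite -sumrN; apply: eq_bigr => v /andP[]; rewrite !inE => /andP[nvu vS] euv.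
rewrite match_poly_sumE -sumrN.
rewrite (reindex_onto (fun M => [set u; v] |: M) (fun M => M :\ [set u; v])) /=.
  rewrite (eq_bigl (is_matching e (S :\ u :\ v))) => [|M].
    apply: eq_bigr => M; rewrite -matching_extend // => /andP[_ /eqP DM].
    have -> : #|[set u; v] |: M| = #|M|.+1.
      by rewrite cardsU1 -{1}DM !inE eqxx.
    rewrite exprS mulN1r scaleNr; congr (- (_ *: 'X^_)).
    have : #|S :\ u| = #|S :\ u :\ v|.+1 by rewrite (cardsD1 v) !inE nvu vS.
    by rewrite cS => ->; rewrite doubleS !subSS.
  rewrite -matching_extend //; case: (_ == M); rewrite ?andbF // !andbT negbK.
  set M' := _ |: M; case mM: (is_matching e S M') => //=.
  have uvM' : [set u; v] \in M' by apply: setU11.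
  have uM' : u \in cover M' by apply/bigcupP; exists [set u; v]; rewrite ?set21.
  rewrite uM' /=; apply/eqP; apply: (matching_unique mM _ uvM').
  by case: (mateP _ mM uM').
move=> M /andP[/andP[mM]]; rewrite negbK => uM /eqP mv; rewrite setD1K //.
by rewrite -mv; case: (mateP _ mM uM).
Qed.

End MatchingRecursion.

Lemma dvdp_bigsum (R : idomainType) (I : finType) (P : pred I)
    (F : I -> {poly R}) d :
  (forall i, P i -> d %| F i) -> d %| \sum_(i | P i) F i.
Proof.
move=> dF; apply: (big_ind (fun p => d %| p)) => //.
exact: dvdp_add.
Qed.

(** * Germs at [theta] that behave like sums of squares *)

Section LocalPositivity.
Variables (R : realFieldType) (theta : R).
Local Notation s := ('X - theta%:P).
Implicit Types (f g p : {poly R}).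

Lemma horner_XsubC_exp n : (s ^+ n).[theta] = (n == 0)%:R.
Proof. by rewrite horner_exp hornerXsubC subrr expr0n. Qed.

Lemma XsubC_exp_neq0 n : s ^+ n != 0.
Proof. by rewrite expf_neq0 // polyXsubC_eq0. Qed.

Lemma mup_factor p : p != 0 ->
  exists2 g, p = s ^+ mup theta p * g & g.[theta] != 0.
Proof.
move=> p0; have := leqnn (mup theta p); rewrite mup_geq // => /dvdpP[g pE].
exists g; first by rewrite mulrC.
apply/negP=> /factor_theorem[h gE]; have := ltnn (mup theta p).
by rewrite mup_geq // {2}pE gE -mulrA -exprS dvdp_mull.
Qed.

Lemma dvd_XsubC_mul n k g : g.[theta] != 0 ->
  (s ^+ n %| s ^+ k * g) = (n <= k)%N.
Proof.
move=> g0; have gN0: g != 0 by apply: contraNneq g0 => ->; rewrite horner0.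
rewrite -mup_geq ?mulf_neq0 ?XsubC_exp_neq0 //.
by rewrite mupMl // mup_XsubCX eqxx.
Qed.

(* The germ of [f] at [theta] is that of a nonnegative function. *)
Definition locpos f :=
  f = 0 \/ exists n g, f = s ^+ n.*2 * g /\ 0 < g.[theta].

Lemma locpos0 : locpos 0. Proof. by left. Qed.

Lemma locpos_sqr f : locpos (f ^+ 2).
Proof.
have [->|f0] := eqVneq f 0; first by rewrite expr0n; left.
have [g fE g0] := mup_factor f0; right; exists (mup theta f), (g ^+ 2).
by rewrite {1}fE exprMn -exprM muln2 horner_exp exprn_even_gt0.
Qed.

Lemma locpos_even n g : locpos (s ^+ n * g) -> g.[theta] != 0 ->
  ~~ odd n /\ 0 < g.[theta].
Proof.
move=> lp g0; have gN0: g != 0 by apply: contraNneq g0 => ->; rewrite horner0.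
case: lp => [/eqP|[k [h [E h0]]]].
  by rewrite mulf_eq0 (negPf gN0) (negPf (XsubC_exp_neq0 _)).
have nk: n = k.*2.
  apply/eqP; rewrite eqn_leq -(dvd_XsubC_mul n k.*2 (lt0r_neq0 h0)) -E.
  by rewrite dvdp_mulr //= -(dvd_XsubC_mul k.*2 n g0) E dvdp_mulr.
move: E; rewrite nk => /(mulfI (XsubC_exp_neq0 _)) ->.
by rewrite odd_double.
Qed.

(** Terms of distinct orders cannot cancel, so [minn a b] is the order of the difference, and a
    locally positive germ has even order. *)
Lemma locpos_sub_parity a b p q : p.[theta] != 0 -> q.[theta] != 0 ->
  locpos (s ^+ a * p - s ^+ b * q) -> a != b -> ~~ odd (minn a b).
Proof.
move=> p0 q0 + nab; have [ltab|] := ltnP a b.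
  rewrite -(subnKC (ltnW ltab)) exprD -mulrA -mulrBr => /locpos_even[] //.
  rewrite hornerD hornerN hornerM horner_XsubC_exp subn_eq0 leqNgt ltab.
  by rewrite mul0r subr0.
rewrite leq_eqVlt eq_sym (negPf nab) => /= ltba.
rewrite -(subnKC (ltnW ltba)) exprD -mulrA -mulrBr => /locpos_even[] //.
rewrite hornerD hornerN hornerM horner_XsubC_exp subn_eq0 leqNgt ltba.
by rewrite mul0r sub0r oppr_eq0.
Qed.

(** Positive leading coefficients cannot cancel, so the order of the sum is the smaller of the two
    orders. *)
Lemma locpos_add_dvd f g : locpos f -> locpos g ->
  locpos (f + g) /\ forall n, s ^+ n %| f + g -> s ^+ n %| f.
Proof.
case=> [->|[a [p [-> p0]]]]; first by rewrite add0r; split=> // n _; exact: dvdp0.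
case=> [->|[b [q [-> q0]]]].
  by rewrite addr0; split=> //; right; exists a, p.
have [ab|ba] := leqP a b.
  have -> : s ^+ a.*2 * p + s ^+ b.*2 * q =
            s ^+ a.*2 * (p + s ^+ (b.*2 - a.*2) * q).
    by rewrite mulrDr mulrA -exprD subnKC // leq_double.
  set h := p + _; have h0: 0 < h.[theta].
    rewrite hornerD hornerM horner_XsubC_exp; apply: ltr_wpDr => //.
    by rewrite mulr_ge0 ?ler0n ?ltW.
  split; first by right; exists a, h.
  by move=> n; rewrite !dvd_XsubC_mul ?gt_eqF.
have -> : s ^+ a.*2 * p + s ^+ b.*2 * q =
          s ^+ b.*2 * (s ^+ (a.*2 - b.*2) * p + q).
  by rewrite mulrDr mulrA -exprD subnKC // leq_double ltnW.
set h := _ + q; have h0: 0 < h.[theta].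
  rewrite hornerD hornerM horner_XsubC_exp; apply: ltr_wpDl => //.
  by rewrite mulr_ge0 ?ler0n ?ltW.
split; first by right; exists b, h.
move=> n; rewrite !dvd_XsubC_mul ?gt_eqF // => /leq_trans; apply.
by rewrite leq_double ltnW.
Qed.

Lemma locposD f g : locpos f -> locpos g -> locpos (f + g).
Proof. by move=> lf lg; case: (locpos_add_dvd lf lg). Qed.

Lemma locpos_dvdDl f g n : locpos f -> locpos g ->
  s ^+ n %| f + g -> s ^+ n %| f.
Proof. by move=> lf lg; case: (locpos_add_dvd lf lg) => _; apply. Qed.

Lemma locpos_dvdDr f g n : locpos f -> locpos g ->
  s ^+ n %| f + g -> s ^+ n %| g.
Proof. by move=> lf lg; rewrite [f + g]addrC; exact: locpos_dvdDl lg lf. Qed.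

Lemma locpos_sum (I : finType) (P : pred I) (F : I -> {poly R}) :
  (forall i, P i -> locpos (F i)) -> locpos (\sum_(i | P i) F i).
Proof. by move=> lF; apply: big_ind => //; [exact: locpos0|exact: locposD]. Qed.

Lemma locpos_dvd_sum (I : finType) (P : pred I) (F : I -> {poly R}) n i :
  (forall i, P i -> locpos (F i)) -> s ^+ n %| \sum_(i | P i) F i -> P i ->
  s ^+ n %| F i.
Proof.
move=> lF dv Pi; move: dv; rewrite (bigD1 i) //=; apply: locpos_dvdDl.
  exact: lF.
by apply: locpos_sum => j /andP[/lF].
Qed.

End LocalPositivity.

Lemma proper_set_ind (T : finType) (P : {set T} -> Prop) :
  (forall S : {set T}, (forall S' : {set T}, S' \proper S -> P S') -> P S) -> forall S, P S.
Proof.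
move=> IH S; have [n] := ubnP #|S|; elim: n S => // n IHn S leS.
by apply: IH => S' /proper_card ltS; apply: IHn; apply: leq_trans ltS _.
Qed.

Lemma setD1C (T : finType) (S : {set T}) u v : S :\ u :\ v = S :\ v :\ u.
Proof. by rewrite !setDDl setUC. Qed.

Lemma eq_match_poly (R : nzRingType) (T : finType) (e e' : rel T) (S : {set T}) :
  {in S &, e =2 e'} -> match_poly R e S = match_poly R e' S.
Proof.
move=> ee'; have eqM M : is_matching e S M = is_matching e' S M.
  congr (_ && _); apply: eq_forallb_in => m _; apply: eq_existsb => x.
  apply: eq_existsb => y; case xS: (x \in S); case yS: (y \in S); rewrite /= ?andbF //.
  by rewrite ee'.
rewrite /match_poly; apply: eq_bigr => r _.
suff -> : nmatch e S r = nmatch e' S r by [].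
by apply: eq_card => M; rewrite !inE eqM.
Qed.

(** * Product, derivative and path-sum identities *)

Section Identities.
Variables (R : realFieldType) (T : finType) (e : rel T).
Hypotheses (e_sym : symmetric e) (e_irr : irreflexive e).
Variable theta : R.
Implicit Types (S C : {set T}) (u v w z : T).
Local Notation mu := (match_poly R e).
Local Notation s := ('X - theta%:P).
Local Notation nbr S u := (fun v => (v \in S :\ u) && e u v).

Lemma mu_rec S u : u \in S ->
  mu S = 'X * mu (S :\ u) - \sum_(v | nbr S u v) mu (S :\ u :\ v).
Proof. exact: match_poly_rec. Qed.

(** Both sides are expanded at a vertex [u] of [S :&: C], all of whose neighbours in [S] lie in [C];
    every term is then covered by induction. *)
Lemma mu_split S C :
  (forall x y, x \in S -> y \in S -> x \in C -> y \notin C -> ~~ e x y) ->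
  mu S = mu (S :&: C) * mu (S :\: C).
Proof.
elim/proper_set_ind: S => S IH noedge.
have [SC0|[u]] := set_0Vmem (S :&: C).
  by rewrite SC0 match_poly0 // mul1r; congr mu; apply/esym/setDidPl; rewrite -setI_eq0 SC0.
rewrite inE => /andP[uS uC].
rewrite (mu_rec uS) (@mu_rec (S :&: C) u) ?inE ?uS // mulrBl mulr_suml.
have sub (X : {set T}) x y : X \subset S -> x \in X -> y \in X -> x \in C -> y \notin C -> ~~ e x y.
  by move=> sX xX yX; apply: noedge; exact: (subsetP sX).
congr (_ - _).
  rewrite IH ?properD1 //; last by move=> x y; apply: sub; rewrite subsetDl.
  rewrite mulrA; congr (_ * mu _ * mu _); apply/setP=> x; rewrite !inE.
    by rewrite andbA.
  by case: eqVneq => // ->; rewrite uC.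
apply: eq_big => [v|v /andP[]].
  rewrite !inE; case vS: (v \in S); rewrite ?andbF //=.
  case vC: (v \in C) => //; rewrite ?andbT // !andbF /=.
  by apply/negbTE; rewrite negb_and noedge ?vC ?orbT.
rewrite !inE => /andP[nvu vS] euv.
have vC : v \in C by apply: contraTT euv; apply: noedge.
have sSuv : S :\ u :\ v \proper S.
  by apply: sub_proper_trans (properD1 uS); apply: subsetDl.
rewrite IH //; last by move=> x y; apply: sub; apply: proper_sub.
congr (mu _ * mu _); apply/setP=> x; rewrite !inE.
  by rewrite !andbA.
by case: eqVneq => [->|_]; rewrite ?vC //=; case: eqVneq => [->|_]; rewrite ?uC.
Qed.

(** The degree is carried through the induction to see that the neighbour sum cannot reach the
    leading term. *)
Lemma mu_monic S : mu S \is monic /\ size (mu S) = #|S|.+1.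
Proof.
elim/proper_set_ind: S => S IH; have [->|[u uS]] := set_0Vmem S.
  by rewrite match_poly0 // monic1 size_poly1 cards0.
have [mon sz] := IH _ (properD1 uS).
have szX : size ('X * mu (S :\ u)) = #|S|.+1.
  by rewrite mulrC size_mulX ?monic_neq0 // sz (cardsD1 u S) uS.
have lt : (size (- \sum_(v | nbr S u v) mu (S :\ u :\ v))%R
           < size ('X * mu (S :\ u))%R)%N.
  rewrite size_polyN szX ltnS (cardsD1 u S) uS.
  apply: leq_trans (size_sum _ _ _) _; apply/bigmax_leqP => v /andP[vS _].
  have [_ ->] := IH (S :\ u :\ v) (sub_proper_trans (subsetDl _ _) (properD1 uS)).
  by rewrite (cardsD1 v (S :\ u)) vS.
rewrite (mu_rec uS); split; last by rewrite size_polyDl.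
by rewrite monicE lead_coefDl // lead_coefM lead_coefX mul1r (monicP mon).
Qed.

Lemma mu_neq0 S : mu S != 0.
Proof. by case: (mu_monic S) => /monic_neq0. Qed.

Lemma mu_dvd n S : (s ^+ n %| mu S) = (n <= mult theta e S)%N.
Proof. by rewrite -mup_geq ?mu_neq0. Qed.

Lemma mult_split S C :
  (forall x y, x \in S -> y \in S -> x \in C -> y \notin C -> ~~ e x y) ->
  mult theta e S = (mult theta e (S :&: C) + mult theta e (S :\: C))%N.
Proof. by move=> /mu_split E; rewrite /mult E mupM ?mu_neq0. Qed.

Lemma deriv_mu_rec S u : u \in S ->
  (mu S)^`() = mu (S :\ u) + 'X * (mu (S :\ u))^`()
               - \sum_(v | nbr S u v) (mu (S :\ u :\ v))^`().
Proof.
move=> uS; rewrite (mu_rec uS) derivB derivM derivX mul1r; congr (_ - _).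
exact: raddf_sum.
Qed.

(** After differentiating the recursion at [u] and exchanging the double sum, the terms belonging to
    [w != u] reassemble into [mu (S :\ w)] by the recursion at [u]. *)
Lemma deriv_mu S : (mu S)^`() = \sum_(u in S) mu (S :\ u).
Proof.
elim/proper_set_ind: S => S IH; have [->|[u uS]] := set_0Vmem S.
  by rewrite match_poly0 // big_set0 derivC.
rewrite (deriv_mu_rec uS) -addrA.
rewrite [RHS](bigD1 u) //=; congr (_ + _).
rewrite IH ?properD1 // mulr_sumr.
under [X in _ - X]eq_bigr => v /andP[vS _].
  rewrite IH; last by apply: sub_proper_trans (properD1 uS); apply: subsetDl.
  over.
rewrite [RHS](eq_bigl (fun w => w \in S :\ u)); last by move=> w; rewrite !inE andbC.
rewrite (exchange_big_dep (fun w => w \in S :\ u)) /=; last first.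
  by move=> v w _; rewrite inE => /andP[].
rewrite -sumrB; apply: eq_bigr => w; rewrite !inE => /andP[nwu wS].
rewrite (@mu_rec (S :\ w) u) ?inE ?uS 1?eq_sym ?nwu // setD1C; congr (_ - _).
apply: eq_big => [v|v _].
  by rewrite !inE nwu wS [w == v]eq_sym !andbT; case: (v == w); rewrite ?andbF ?andbT.
by rewrite setD1C [S :\ w :\ u]setD1C.
Qed.

(** The numerator of the derivative of [mu S / mu (S :\ u)]. Iterating [wronski_rec] makes it the
    sum of [mu (S :\: P) ^+ 2] over the paths [P] of [S] that start at [u]. *)
Definition wronski S u := (mu S)^`() * mu (S :\ u) - mu S * (mu (S :\ u))^`().

Lemma wronski_rec S u : u \in S ->
  wronski S u = mu (S :\ u) ^+ 2 + \sum_(v | nbr S u v) wronski (S :\ u) v.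
Proof.
move=> uS; rewrite /wronski sumrB -!mulr_sumr.
rewrite (deriv_mu_rec uS) (mu_rec uS); ring.
Qed.

Lemma locpos_wronski S u : u \in S -> locpos theta (wronski S u).
Proof.
elim/proper_set_ind: S u => S IH u uS; rewrite wronski_rec //.
apply: locposD; first exact: locpos_sqr.
by apply: locpos_sum => v /andP[vS _]; apply: IH => //; apply: properD1.
Qed.

Lemma wronski_dvd_sqr S u n : u \in S -> s ^+ n %| wronski S u ->
  s ^+ n %| mu (S :\ u) ^+ 2.
Proof.
move=> uS; rewrite wronski_rec //; apply: locpos_dvdDl; first exact: locpos_sqr.
by apply: locpos_sum => v /andP[vS _]; apply: locpos_wronski.
Qed.

(** Without cancellation, a power dividing the sum in [wronski_rec] divides each summand; this moves
    divisibility along a path. *)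
Lemma wronski_dvd_step S u v n : u \in S -> v \in S :\ u -> e u v ->
  s ^+ n %| wronski S u -> s ^+ n %| wronski (S :\ u) v.
Proof.
move=> uS vS euv; rewrite wronski_rec // => /locpos_dvdDr dv.
have lp w : nbr S u w -> locpos theta (wronski (S :\ u) w).
  by case/andP=> wS _; apply: locpos_wronski.
apply: (locpos_dvd_sum lp); last by rewrite vS.
by apply: dv; [exact: locpos_sqr | exact: locpos_sum].
Qed.

(* Equal to the sum of [mu (S :\: P) ^+ 2] over the paths [P] of [S] from [u]
   to [v] (Heilmann-Lieb); the case [u = v] makes the recursion uniform. *)
Definition two_point S u v :=
  if u == v then mu (S :\ v) ^+ 2
  else mu (S :\ u) * mu (S :\ v) - mu S * mu (S :\ u :\ v).

(** Both [mu S] and [mu (S :\ v)] are expanded at [u]; an edge [uv] contributes the square in the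
    diagonal branch of [two_point]. *)
Lemma two_point_rec S u v : u \in S -> v \in S -> u != v ->
  two_point S u v = \sum_(w | nbr S u w) two_point (S :\ u) w v.
Proof.
move=> uS vS nuv; rewrite /two_point (negPf nuv).
rewrite (mu_rec uS) (@mu_rec (S :\ v) u) ?inE ?uS ?nuv //.
rewrite (setD1C S v u).
have split (F : T -> {poly R}) : \sum_(w | nbr S u w) F w =
    (if e u v then F v else 0) + \sum_(w | nbr (S :\ v) u w) F w.
  case euv: (e u v).
    rewrite (bigD1 v) /= ?inE ?vS ?euv 1?eq_sym ?nuv //; congr (_ + _).
    apply: eq_bigl => w; rewrite !inE; case: (w == v); rewrite ?andbF ?andbT //=.
  rewrite add0r; apply: eq_bigl => w; rewrite !inE.
  by case: (eqVneq w v) => [->|]; rewrite ?euv ?andbF.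
rewrite !split eqxx.
have -> : \sum_(w | nbr (S :\ v) u w)
     (if w == v then mu (S :\ u :\ v) ^+ 2
      else mu (S :\ u :\ w) * mu (S :\ u :\ v) - mu (S :\ u) * mu (S :\ u :\ w :\ v))
   = (\sum_(w | nbr (S :\ v) u w) mu (S :\ u :\ w)) * mu (S :\ u :\ v)
   - mu (S :\ u) * (\sum_(w | nbr (S :\ v) u w) mu (S :\ u :\ v :\ w)).
  rewrite mulr_suml mulr_sumr -sumrB; apply: eq_bigr => w.
  by rewrite !inE => /andP[/and3P[_ /negPf-> _] _]; rewrite [_ :\ w :\ v]setD1C.
by rewrite (setD1C S v u); case: (e u v); ring.
Qed.

Lemma locpos_two_point S u v : u \in S -> v \in S -> locpos theta (two_point S u v).
Proof.
elim/proper_set_ind: S u => S IH u uS vS.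
have [->|nuv] := eqVneq u v; first by rewrite /two_point eqxx; apply: locpos_sqr.
rewrite two_point_rec //; apply: locpos_sum => w /andP[wS _]; apply: IH => //.
  exact: properD1.
by rewrite !inE eq_sym nuv.
Qed.

Lemma two_point_dvd_step S u v w n : u \in S -> v \in S -> u != v ->
  w \in S :\ u -> e u w -> s ^+ n %| two_point S u v ->
  s ^+ n %| two_point (S :\ u) w v.
Proof.
move=> uS vS nuv wS euw; rewrite two_point_rec // => dv.
apply: (locpos_dvd_sum _ dv); last by rewrite wS.
move=> x /andP[xS _]; apply: locpos_two_point => //.
by rewrite !inE eq_sym nuv.
Qed.

(* Equal to the sum of [mu (S :\: P) * mu (S :\: P :\ v)] over paths [P] from
   [z] to [w] avoiding [v], plus the same sum with [v] and [w] exchanged. *)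
Definition three_point S z w v :=
  if z == w then mu (S :\ w) * mu (S :\ w :\ v)
  else if z == v then mu (S :\ v) * mu (S :\ w :\ v)
  else mu (S :\ z) * mu (S :\ w :\ v) - mu S * mu (S :\ z :\ w :\ v).

Lemma three_point_rec S z w v : z \in S -> w \in S -> v \in S ->
  z != w -> z != v -> w != v ->
  three_point S z w v = \sum_(y | nbr S z y) three_point (S :\ z) y w v.
Proof.
move=> zS wS vS nzw nzv nwv; rewrite /three_point (negPf nzw) (negPf nzv).
rewrite (mu_rec zS) (@mu_rec (S :\ w :\ v) z) ?inE ?zS ?nzw ?nzv //.
have D1 : S :\ w :\ v :\ z = S :\ z :\ w :\ v by rewrite setD1C (setD1C S w z).
rewrite !D1.
have split (F : T -> {poly R}) : \sum_(y | nbr S z y) F y =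
    (if e z w then F w else 0) + (if e z v then F v else 0)
    + \sum_(y | nbr (S :\ w :\ v) z y) F y.
  rewrite (bigID (fun y => y == w)) /= -addrA; congr (_ + _).
    case ezw: (e z w).
      rewrite (big_pred1 w) // => y; rewrite !inE.
      by case: (eqVneq y w) => [->|]; rewrite ?andbF // ezw wS eq_sym nzw.
    by rewrite big_pred0 // => y; case: (eqVneq y w) => [->|]; rewrite ?ezw ?andbF.
  rewrite (bigID (fun y => y == v)) /=; congr (_ + _).
    case ezv: (e z v).
      rewrite (big_pred1 v) // => y; rewrite !inE.
      by case: (eqVneq y v) => [->|]; rewrite ?andbF // ezv vS eq_sym nzv eq_sym nwv.
    by rewrite big_pred0 // => y; case: (eqVneq y v) => [->|]; rewrite ?ezv ?andbF.
  apply: eq_bigl => y; rewrite !inE.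
  by case: (y == w); case: (y == v); case: (y == z); rewrite ?andbF ?andbT.
rewrite !split !eqxx eq_sym (negPf nwv).
have -> : \sum_(y | nbr (S :\ w :\ v) z y)
   (if y == w then mu (S :\ z :\ w) * mu (S :\ z :\ w :\ v)
    else if y == v then mu (S :\ z :\ v) * mu (S :\ z :\ w :\ v)
    else mu (S :\ z :\ y) * mu (S :\ z :\ w :\ v)
         - mu (S :\ z) * mu (S :\ z :\ y :\ w :\ v))
  = (\sum_(y | nbr (S :\ w :\ v) z y) mu (S :\ z :\ y)) * mu (S :\ z :\ w :\ v)
    - mu (S :\ z) * (\sum_(y | nbr (S :\ w :\ v) z y) mu (S :\ z :\ w :\ v :\ y)).
  rewrite [X in _ = X - _]mulr_suml [X in _ = _ - X]mulr_sumr -sumrB; apply: eq_bigr => y.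
  rewrite !inE => /andP[/and4P[_ /negPf-> /negPf-> _] _].
  by rewrite (setD1C (S :\ z) y w) (setD1C _ y v).
by rewrite !D1; case: (e z w); case: (e z v); ring.
Qed.

(** The order of a square is even, so for [n > 0] the odd exponent [2 * n - 1] already forces
    [2 * n]. *)
Lemma sqr_dvd n S : s ^+ (n.*2.-1) %| mu S ^+ 2 -> s ^+ n %| mu S.
Proof.
rewrite -!mup_geq ?expf_neq0 ?mu_neq0 // expr2 mupM ?mu_neq0 //; lia.
Qed.

(** All three hypotheses pass to every term of [three_point_rec]. Where the path ends, at [w] or
    [v], the Wronskian gives order [a] for one factor and a two-point function gives order [b] for
    the other. *)
Lemma three_point_dvd a b S z w v :
  z \in S -> w \in S -> v \in S -> w != v ->
  s ^+ (a.*2.-1) %| wronski S z ->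
  (z != v -> s ^+ (b.*2.-1) %| two_point (S :\ v) z w) ->
  (z != w -> s ^+ (b.*2.-1) %| two_point (S :\ w) z v) ->
  s ^+ (a + b) %| three_point S z w v.
Proof.
elim/proper_set_ind: S z => S IH z zS wS vS nwv dW dv dw.
have [zw|nzw] := eqVneq z w.
  rewrite /three_point zw eqxx exprD; apply: dvdp_mul; apply: sqr_dvd.
    by apply: wronski_dvd_sqr; rewrite -?zw.
  by move: dv; rewrite zw /two_point eqxx setD1C; apply.
have [zv|nzv] := eqVneq z v.
  rewrite /three_point (negPf nzw) zv eqxx exprD; apply: dvdp_mul; apply: sqr_dvd.
    by apply: wronski_dvd_sqr; rewrite -?zv.
  by move: (dw nzw); rewrite zv /two_point eqxx.
rewrite three_point_rec //; apply: dvdp_bigsum => y /andP[yS ezy].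
have wSz: w \in S :\ z by rewrite !inE eq_sym nzw.
have vSz: v \in S :\ z by rewrite !inE eq_sym nzv.
apply: IH => //; first exact: properD1.
- exact: wronski_dvd_step.
- move=> nyv; rewrite setD1C; apply: two_point_dvd_step => //.
  + by rewrite !inE nzv.
  + by rewrite !inE nwv.
  + by rewrite setD1C !inE nyv andTb -in_setD1.
  exact: dv.
- move=> nyw; rewrite setD1C; apply: two_point_dvd_step => //.
  + by rewrite !inE nzw.
  + by rewrite !inE eq_sym nwv.
  + by rewrite setD1C !inE nyw andTb -in_setD1.
  exact: dw.
Qed.

End Identities.

(** * Interlacing, special vertices, stability and Gallai's lemma *)

Section Multiplicities.
Variables (R : realFieldType) (T : finType) (e : rel T).
Hypotheses (e_sym : symmetric e) (e_irr : irreflexive e).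
Variable theta : R.
Implicit Types (S C : {set T}) (u v w y z : T).
Local Notation mu := (match_poly R e).
Local Notation s := ('X - theta%:P).
Local Notation nbr S u := (fun v => (v \in S :\ u) && e u v).
Local Notation m := (mult theta e).
Local Notation W := (wronski R e).

Lemma mu_factor S : exists2 g, mu S = s ^+ m S * g & g.[theta] != 0.
Proof. by apply: mup_factor; apply: mu_neq0. Qed.

Lemma mu_mul_dvd n S1 S2 : (s ^+ n %| mu S1 * mu S2) = (n <= m S1 + m S2)%N.
Proof. by rewrite -mup_geq ?mulf_neq0 ?mu_neq0 // mupM ?mu_neq0. Qed.

Lemma deriv_XsubC_exp n : (s ^+ n)^`() = s ^+ n.-1 *+ n.
Proof. by rewrite deriv_exp derivXsubC mul1r. Qed.

Lemma dvd_deriv n (p : {poly R}) : s ^+ n %| p -> s ^+ n.-1 %| p^`().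
Proof.
case/dvdpP=> q ->; rewrite derivM dvdp_add //.
  by rewrite dvdp_mull // dvdp_exp2l // leq_pred.
by rewrite deriv_XsubC_exp dvdp_mull // -mulr_natr dvdp_mulr.
Qed.

Lemma wronski_dvd S u : s ^+ (m S + m (S :\ u)).-1 %| W S u.
Proof.
have dS : s ^+ m S %| mu S by rewrite mu_dvd.
have dSu : s ^+ m (S :\ u) %| mu (S :\ u) by rewrite mu_dvd.
rewrite /wronski dvdp_sub //.
  apply: dvdp_trans (dvdp_mul (dvd_deriv dS) dSu).
  by rewrite -exprD dvdp_exp2l //; lia.
apply: dvdp_trans (dvdp_mul dS (dvd_deriv dSu)).
by rewrite -exprD dvdp_exp2l //; lia.
Qed.

(** The square [mu (S :\ u) ^+ 2] is a summand of the Wronskian, whose order is at least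
    [m S + m (S :\ u) - 1]. *)
Lemma mult_le_del S u : (m S <= (m (S :\ u)).+1)%N.
Proof.
case uS: (u \in S); last first.
  rewrite (_ : S :\ u = S) ?leqnSn //; apply/setP=> x; rewrite !inE.
  by case: eqVneq => // ->.
have := wronski_dvd_sqr e_sym e_irr uS (wronski_dvd S u).
by rewrite expr2 mu_mul_dvd; lia.
Qed.

(** By [mult_le_del] each neighbour term of the recursion at [u] has order at least
    [m (S :\ u) - 1]. *)
Lemma mult_del_le S u : (m (S :\ u) <= (m S).+1)%N.
Proof.
case uS: (u \in S); last first.
  rewrite (_ : S :\ u = S) ?leqnSn //; apply/setP=> x; rewrite !inE.
  by case: eqVneq => // ->.
suff : ((m (S :\ u)).-1 <= m S)%N by lia.
rewrite -mu_dvd // (mu_rec R e_sym e_irr uS) dvdp_sub //.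
  by rewrite dvdp_mull // mu_dvd // leq_pred.
apply: dvdp_bigsum => v _; rewrite mu_dvd //.
by have := mult_le_del (S :\ u) v; lia.
Qed.

(** The argument of [mult_le_del] one step further along a path: [mu (S :\ u :\ v) ^+ 2] is a
    summand of the Wronskian too. *)
Lemma mult_edge S u v : u \in S -> v \in S :\ u -> e u v ->
  (m S + m (S :\ u) <= (m (S :\ u :\ v)).*2.+1)%N.
Proof.
move=> uS vS euv.
have := wronski_dvd_step e_sym e_irr uS vS euv (wronski_dvd S u).
move/(wronski_dvd_sqr e_sym e_irr vS); rewrite expr2 mu_mul_dvd; lia.
Qed.

(** The coefficient of order [2 * l] in the Wronskian is [((l + 1) - l) * g * h] at [theta], so
    local positivity fixes its sign. *)
Lemma essential_sign S u g h : u \in S -> m S = (m (S :\ u)).+1 ->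
  mu S = s ^+ m S * g -> mu (S :\ u) = s ^+ m (S :\ u) * h ->
  (g * h).[theta] != 0 -> 0 < (g * h).[theta].
Proof.
move=> uS mS gE hE gh0; set l := m (S :\ u) in mS hE.
have WE : W S u = s ^+ l.*2 * (g * h + s * (g^`() * h - g * h^`())).
  rewrite /wronski gE hE mS !derivM !deriv_XsubC_exp /= -addnn exprD exprS.
  have : s * (s ^+ l.-1 *+ l) = s ^+ l *+ l.
    by rewrite mulrnAr -exprS; case: (l).
  rewrite mulrS; move: (s ^+ l.-1 *+ l) (s ^+ l) => Q P <-.
  move: (s) g^`() h^`() => t dg dh; ring.
have := locpos_wronski e_sym e_irr theta uS; rewrite WE => /locpos_even.
by rewrite !hornerE subrr mul0r addr0 -hornerM => /(_ gh0) [].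
Qed.

(** In the recursion at [w] the neighbour terms of least order [l] all have the sign of the leading
    coefficient [g] of [mu (S :\ w)]. They cannot cancel, while ['X * mu (S :\ w)] has order above
    [l]; hence [m S = l]. *)
Lemma positive_of_essential_nbr S w z : w \in S -> z \in S :\ w -> e w z ->
  m (S :\ w) = (m (S :\ w :\ z)).+1 -> m (S :\ w) = (m S).+1.
Proof.
move=> wS zS ewz mz; set l := m (S :\ w :\ z) in mz.
have := mult_del_le S w; have := mult_le_del S w.
suff : ~~ (l.+1 <= m S)%N by lia.
rewrite -mu_dvd //; apply/negP=> dS.
have [g gE g0] := mu_factor (S :\ w).
pose t v := mu (S :\ w :\ v) %/ s ^+ l.
have tE v : mu (S :\ w :\ v) = s ^+ l * t v.
  rewrite mulrC /t divpK // mu_dvd //.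
  by have := mult_le_del (S :\ w) v; lia.
have t_ge0 v : v \in S :\ w -> 0 <= (g * t v).[theta].
  move=> vS; have [t0|t0] := eqVneq (t v).[theta] 0.
    by rewrite hornerM t0 mulr0.
  have mv : m (S :\ w :\ v) = l.
    by rewrite /mult tE mupMl // mup_XsubCX eqxx.
  apply: ltW; apply: (@essential_sign (S :\ w) v) => //; rewrite ?mv //.
  by rewrite hornerM mulf_neq0.
have tz : 0 < (g * t z).[theta].
  rewrite lt0r t_ge0 // andbT hornerM mulf_neq0 //.
  apply/negP=> /factor_theorem[q qE]; have := ltnn l.
  rewrite -(mu_dvd e_sym e_irr theta l.+1 (S :\ w :\ z)) tE qE mulrCA -exprSr.
  by rewrite dvdp_mull.
have : s ^+ l.+1 %| s ^+ l * \sum_(v | nbr S w v) t v.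
  rewrite mulr_sumr; under eq_bigr => v _ do rewrite -tE.
  have -> : \sum_(v | nbr S w v) mu (S :\ w :\ v) = 'X * mu (S :\ w) - mu S.
    by rewrite (mu_rec R e_sym e_irr wS); ring.
  by rewrite dvdp_sub // dvdp_mull // mu_dvd // mz.
apply/negP; rewrite dvd_XsubC_mul ?ltnn //.
have : 0 < \sum_(v | nbr S w v) (g * t v).[theta].
  rewrite (bigD1 z) ?zS //= ltr_pwDl // sumr_ge0 // => v /andP[/andP[vS _] _].
  exact: t_ge0.
under eq_bigr => v _ do rewrite hornerM.
by rewrite -mulr_sumr -horner_sum; case: eqP => // ->; rewrite mulr0 ltxx.
Qed.

(** Without such a neighbour every term of the recursion at [w] would have order at least
    [m S + 1]. *)
Lemma essential_nbr_of_positive S w : w \in S -> m (S :\ w) = (m S).+1 ->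
  exists z, [/\ z \in S :\ w, e w z & m (S :\ w) = (m (S :\ w :\ z)).+1].
Proof.
move=> wS pos.
case: (pickP (fun z => (z \in S :\ w) && e w z
                       && (m (S :\ w) == (m (S :\ w :\ z)).+1))).
  by move=> z /andP[/andP[zS ewz] /eqP E]; exists z.
move=> none; have := ltnn (m S); rewrite -pos -mu_dvd // (mu_rec R e_sym e_irr wS).
rewrite dvdp_sub // ?dvdp_mull ?mu_dvd //.
apply: dvdp_bigsum => v nv; rewrite mu_dvd //.
by have := none v; rewrite nv /=; have := mult_le_del (S :\ w) v; lia.
Qed.

(** Otherwise all summands of [deriv_mu] would have order at least [m S], whereas the derivative has
    order exactly [m S - 1]. *)
Lemma exists_essential S : (0 < m S)%N ->
  exists2 u, u \in S & m S = (m (S :\ u)).+1.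
Proof.
move=> mS; case: (pickP (fun u => (u \in S) && (m S == (m (S :\ u)).+1))).
  by move=> u /andP[uS /eqP E]; exists u.
move=> none; have [g gE g0] := mu_factor S.
have : s ^+ m S %| (mu S)^`().
  rewrite deriv_mu //; apply: dvdp_bigsum => u uS; rewrite mu_dvd //.
  by have := none u; rewrite uS /=; have := mult_le_del S u; lia.
rewrite gE derivM deriv_XsubC_exp => dv.
have : s ^+ m S %| s ^+ (m S).-1 * (g *+ m S).
  rewrite mulrnAr -mulrnAl -(addrK (s ^+ m S * g^`()) (_ * g)).
  by rewrite dvdp_sub // dvdp_mulr.
rewrite dvd_XsubC_mul; first by lia.
by rewrite hornerMn mulrn_eq0 negb_or g0 andbT; lia.
Qed.

Lemma two_point_parity S u v : u \in S -> v \in S -> u != v ->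
  (m (S :\ u) + m (S :\ v) != m S + m (S :\ u :\ v))%N ->
  ~~ odd (minn (m (S :\ u) + m (S :\ v)) (m S + m (S :\ u :\ v))).
Proof.
move=> uS vS nuv.
have [g gE g0] := mu_factor S; have [gu guE gu0] := mu_factor (S :\ u).
have [gv gvE gv0] := mu_factor (S :\ v).
have [h hE h0] := mu_factor (S :\ u :\ v).
apply: (@locpos_sub_parity _ theta _ _ (gu * gv) (g * h)).
- by rewrite hornerM mulf_neq0.
- by rewrite hornerM mulf_neq0.
rewrite !exprD mulrACA [X in _ - X]mulrACA -guE -gvE -gE -hE.
by have := locpos_two_point e_sym e_irr theta uS vS; rewrite /two_point (negPf nuv).
Qed.

Lemma two_point_dvd S u v n : u != v ->
  (n <= m (S :\ u) + m (S :\ v))%N -> (n <= m S + m (S :\ u :\ v))%N ->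
  s ^+ n %| two_point R e S u v.
Proof.
by move=> nuv n1 n2; rewrite /two_point (negPf nuv) dvdp_sub // mu_mul_dvd.
Qed.

(** If [y] were neutral, [mult_edge] would give [m (S :\ y :\ z) >= m S], and the two-point function
    of [y] and [z] would have the odd order [2 * m S - 1]. *)
Lemma special_positive S y z : y \in S -> z \in S -> e y z ->
  (m (S :\ y)).+1 != m S -> (m (S :\ z)).+1 = m S -> m (S :\ y) = (m S).+1.
Proof.
move=> yS zS eyz ny ez; have := mult_del_le S y; have := mult_le_del S y.
have nyz : y != z by apply: contraTneq eyz => ->; rewrite e_irr.
have zSy : z \in S :\ y by rewrite !inE eq_sym nyz.
have := mult_edge yS zSy eyz; have := @two_point_parity S y z yS zS nyz.
lia.
Qed.

(* "[mult (F :\ u :\ z)] is not [mult F - 2]" is a transitive relation between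
   essential vertices: otherwise the three-point function of [u], [z], [w]
   would have order both exactly [2 * mult F - 3] and at least [2 * mult F - 2]. *)
Lemma essential_trans (F : {set T}) u z w :
  u \in F -> z \in F -> w \in F -> u != z -> u != w -> z != w ->
  (m (F :\ u)).+1 = m F -> (m (F :\ z)).+1 = m F -> (m (F :\ w)).+1 = m F ->
  (m F <= (m (F :\ u :\ z)).+1)%N -> (m F <= (m (F :\ u :\ w)).+1)%N ->
  (m F <= (m (F :\ z :\ w)).+1)%N.
Proof.
move=> uF zF wF nuz nuw nzw mu_ mz mw muz muw; rewrite leqNgt; apply/negP=> lt.
have muzw := mult_le_del (F :\ u :\ z) w.
have mzw := mult_le_del (F :\ z) w.
pose a := (m F).-1.
have : s ^+ (a + a) %| three_point R e F u z w.
  apply: three_point_dvd => //.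
  - apply: dvdp_trans (wronski_dvd F u); apply: dvdp_exp2l; rewrite /a; lia.
  - move=> _; apply: two_point_dvd => //.
      by rewrite (setD1C F w u) (setD1C F w z) /a; lia.
    by rewrite (setD1C F w u) (setD1C _ w z) /a; lia.
  - move=> _; apply: two_point_dvd => //.
      by rewrite (setD1C F z u) /a; lia.
    by rewrite (setD1C F z u) /a; lia.
rewrite /three_point (negPf nuz) (negPf nuw) dvdp_subl.
  by rewrite mu_mul_dvd /a; lia.
by rewrite mu_mul_dvd /a; lia.
Qed.

Lemma AsetP S y :
  reflect [/\ y \in S, (m (S :\ y)).+1 != m S &
              exists z, [/\ z \in S, (m (S :\ z)).+1 = m S & e y z]]
          (y \in Aset theta e S).
Proof.
rewrite !inE /essential; case yS: (y \in S) => /=; last by constructor=> -[].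
apply: (iffP andP) => [[ny /exists_inP[z]]|[_ ny [z [zS mz eyz]]]].
  by rewrite !inE => /andP[zS /andP[_ /eqP mz]] eyz; split=> //; exists z.
split=> //; apply/exists_inP; exists z => //.
by rewrite !inE /essential zS mz eqxx.
Qed.

Lemma Aset_positive S y : y \in Aset theta e S -> m (S :\ y) = (m S).+1.
Proof.
by case/AsetP=> yS ny [z [zS mz eyz]]; apply: special_positive eyz ny mz.
Qed.

(** For [u] essential in [S] interlacing suffices. Otherwise parity leaves only the case of [u]
    essential in [S :\ y], which is refuted by transitivity. *)
Lemma stability S y u : y \in Aset theta e S -> u \in S -> u != y ->
  m (S :\ y :\ u) = (m (S :\ u)).+1.
Proof.
move=> yA uS nuy; have mSy := Aset_positive yA.
case/AsetP: yA => yS ny [z [zS mz eyz]].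
have nyz : y != z by apply: contraTneq eyz => ->; rewrite e_irr.
have D1 := mult_le_del S u; have D2 := mult_del_le S u.
have D3 := mult_le_del (S :\ y) u; have D4 := mult_del_le (S :\ u) y.
rewrite setD1C in D4.
have [eu|nu] := eqVneq (m (S :\ u)).+1 (m S); first by move: D3 D4 eu mSy; clear; lia.
suff : (m (S :\ y :\ u)).+1 != m (S :\ y).
  move=> nuSy; have := @two_point_parity S u y uS yS nuy.
  by rewrite (setD1C S u y); move: D1 D2 D3 D4 nu mSy nuSy; clear; lia.
apply/negP=> /eqP eu.
(* If this failed, [w] would be essential in [S :\ u :\ y], making [y] positive in [S :\ u] and
   hence [u] essential in [S]. *)
have nbr_u w : w \in S -> w != y -> w != u -> e y w ->
    (m (S :\ y) <= (m (S :\ y :\ u :\ w)).+1)%N.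
  move=> wS nwy nwu eyw; rewrite leqNgt; apply/negP=> lt.
  have := @positive_of_essential_nbr (S :\ u) y w.
  rewrite (setD1C S u y) !inE eq_sym nuy yS nwy nwu wS => /(_ isT isT eyw).
  move: (mult_le_del (S :\ y :\ u) w) lt eu D1 mSy nu; clear; lia.
have nzu : z != u by apply: contraNneq nu => <-; apply/eqP.
have mSyz : m (S :\ y :\ z) = m S.
  have := mult_le_del (S :\ y) z; have := mult_del_le (S :\ z) y.
  by rewrite (setD1C S z y); move: mSy mz; clear; lia.
have nzy : z != y by rewrite eq_sym.
(* As [y] is positive in [S :\ z], it has a neighbour [w] whose deletion after [z] brings [S :\ y]
   down by two: [z] and [w] are unrelated, yet [nbr_u] relates [u] to both. *)
have [||w] := @essential_nbr_of_positive (S :\ z) y.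
- by rewrite !inE nyz.
- by rewrite (setD1C S z y) mSyz mz.
rewrite (setD1C S z y) !inE => -[/and3P[nwz nwy wS] eyw mw].
have zu := nbr_u z zS nzy nzu eyz.
have nwu : w != u.
  by apply/eqP=> wu; move: zu mw; rewrite wu (setD1C _ z u) mSy mSyz; clear; lia.
have wu := nbr_u w wS nwy nwu eyw.
have mSyw := mult_le_del (S :\ y) w.
have mSyw2 := mult_del_le (S :\ y :\ w) z.
rewrite (setD1C _ w z) in mSyw2.
have mSyw3 := mult_le_del (S :\ y :\ w) z.
rewrite (setD1C _ w z) in mSyw3.
have := @essential_trans (S :\ y) u z w.
rewrite !inE nuy uS nwy wS zS nzy [u == z]eq_sym nzu [u == w]eq_sym nwu.
rewrite [z == w]eq_sym nwz.
do 6 move=> /(_ isT).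
move: eu mSy mSyz mw zu wu mSyw mSyw2 mSyw3; clear; lia.
Qed.

(** By [stability] deleting [y] shifts [m S] and every [m (S :\ u)] with [u != y] alike, so the
    essential vertices stay the same. *)
Lemma Aset_del S y : y \in Aset theta e S ->
  Aset theta e (S :\ y) = Aset theta e S :\ y.
Proof.
move=> yA; have mSy := Aset_positive yA.
have ess u : u \in S -> u != y -> ((m (S :\ y :\ u)).+1 == m (S :\ y)) = ((m (S :\ u)).+1 == m S).
  by move=> uS nuy; rewrite (stability yA) // mSy eqSS.
apply/setP=> x; rewrite [RHS]in_setD1; apply/AsetP/andP.
  case=> /setD1P[nxy xS] nx [z [/setD1P[nzy zS] mz exz]].
  split=> //; apply/AsetP; split=> //; first by rewrite -ess.
  by exists z; split=> //; apply/eqP; rewrite -ess // mz.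
case=> nxy /AsetP[xS nx [z [zS mz exz]]].
have nzy : z != y by apply/eqP=> zy; case/AsetP: yA => _ /eqP; rewrite -zy.
split; first by rewrite !inE nxy.
  by rewrite ess.
by exists z; rewrite !inE nzy; split=> //; apply/eqP; rewrite ess // mz.
Qed.

Lemma Aset_structure S (A := Aset theta e S) :
  [/\ m (S :\: A) = (m S + #|A|)%N, Aset theta e (S :\: A) = set0 &
      forall u, u \in S :\: A -> m (S :\: A :\ u) = (m (S :\ u) + #|A|)%N].
Proof.
rewrite {}/A; have [n] := ubnP #|Aset theta e S|; elim: n S => // n IH S.
have [A0|[y yA]] := set_0Vmem (Aset theta e S).
  by rewrite A0 setD0 cards0 addn0; split=> // u _; rewrite addn0.
rewrite (cardsD1 y) yA -Aset_del // => /(IH (S :\ y)).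
have -> : S :\ y :\: Aset theta e (S :\ y) = S :\: Aset theta e S.
  by rewrite Aset_del // setDDl setD1K.
case=> mA A0 mu_; have mSy := Aset_positive yA.
split=> // [|u uSA]; first by rewrite mA mSy addSnnS.
rewrite mu_ // (stability yA) ?addSnnS //; move: uSA; rewrite inE => /andP[uA uS] //.
by apply: contraNneq uA => ->.
Qed.

(** Gallai's lemma. If [m (C :\ x) > 0], connectedness yields a special vertex [y] of [C :\ x], and
    [stability] at [y] produces a neighbour of [x] essential in [C :\ x], against [mult_edge]. *)
Lemma critical_mult C : critical theta e C -> m C = 1%N.
Proof.
case/and3P=> /set0Pn[x xC] /forall_inP conn /forall_inP ess.
have essC u : u \in C -> (m (C :\ u)).+1 = m C.
  by move=> /ess /andP[_ /eqP].
have mC := essC x xC; apply/eqP; rewrite -mC eqSS -leqn0 leqNgt; apply/negP=> gt0.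
have [b bCx mb] := exists_essential gt0.
have xnbr z : z \in C :\ x -> e x z -> m (C :\ x) != (m (C :\ x :\ z)).+1.
  by move=> zC exz; have := mult_edge xC zC exz; lia.
pose E := Bset theta e (C :\ x).
have EP z : (z \in E) = (z \in C :\ x) && ((m (C :\ x :\ z)).+1 == m (C :\ x)).
  by rewrite inE /essential andbA andbb.
have [y yA] : exists y, y \in Aset theta e (C :\ x).
  apply/set0Pn; apply/negP=> /eqP A0.
  (* With no special vertex, essentiality in [C :\ x] spreads along edges and never meets a
     neighbour of [x], so no path from [b] could reach [x]. *)
  have closE p a : a \in E -> path (restr e C) a p -> last a p \in E.
    elim: p a => //= c p IH a aE /andP[/and3P[aC cC eac]]; apply: IH.
    move: aE; rewrite !EP => /andP[aCx /eqP ma].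
    have ncx : c != x.
      apply: contraTneq eac => ->; rewrite e_sym; apply/negP=> /(xnbr a aCx).
      by rewrite ma eqxx.
    rewrite in_setD1 ncx cC; apply: contraT => /= nc.
    suff : c \in Aset theta e (C :\ x) by rewrite A0 inE.
    apply/AsetP; split; rewrite ?in_setD1 ?ncx //.
    by exists a; split; rewrite // e_sym.
  have bE : b \in E by rewrite EP bCx mb eqxx.
  have /forall_inP/(_ x xC)/connectP[p pth xE] := conn b (subsetP (subsetDl _ _) _ bCx).
  by have := closE _ _ bE pth; rewrite -xE EP !inE eqxx.
have mCxy := Aset_positive yA; have [yCx _ _] := AsetP _ _ yA.
move: (yCx); rewrite in_setD1 => /andP[nyx yC].
have mCy := essC y yC.
(* Here [x] is positive in [C :\ y], since [m (C :\ y) = m (C :\ x)] and [y] is positive in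
   [C :\ x]. *)
have [||z [zC exz mz]] := @essential_nbr_of_positive (C :\ y) x.
- by rewrite in_setD1 eq_sym nyx.
- by rewrite setD1C; lia.
have zCx : z \in C :\ x by move: zC; rewrite !inE => /and3P[-> _ ->].
have nzy : z != y by move: zC; rewrite !inE => /and3P[].
move: mz (stability yA zCx nzy) (xnbr z zCx exz).
rewrite (setD1C C y x); move: mCxy; clear; lia.
Qed.

End Multiplicities.

(** * Multiplicities of components, and universal vertices *)

Section Components.
Variables (R : realFieldType) (T : finType) (e : rel T).
Hypotheses (e_sym : symmetric e) (e_irr : irreflexive e).
Variable theta : R.
Implicit Types (S C W : {set T}) (u v w x y z : T).
Local Notation m := (mult theta e).

Lemma restr_connect_sym W : connect_sym (restr e W).
Proof. by apply: sym_connect_sym => x y; rewrite /restr e_sym andbCA. Qed.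

Lemma component_refl W x : x \in W -> x \in component e W x.
Proof. by move=> xW; rewrite inE xW connect0. Qed.

Lemma component_sub W x : component e W x \subset W.
Proof. by apply/subsetP=> y; rewrite inE => /andP[]. Qed.

Lemma component_edge W x a b : a \in W -> b \in W -> a \in component e W x ->
  e a b -> b \in component e W x.
Proof.
move=> aW bW; rewrite !inE aW bW /= => xa eab; apply: connect_trans xa _.
by apply: connect1; rewrite /restr aW bW.
Qed.

Lemma component_id W C a : is_component e W C -> a \in C -> C = component e W a.
Proof.
case/exists_inP=> x xW /eqP->; rewrite inE => /andP[aW xa].
apply/setP=> y; rewrite !inE; congr (_ && _).
exact: same_connect (@restr_connect_sym W) _ _ xa y.
Qed.

Lemma component_is_component W x : x \in W -> is_component e W (component e W x).
Proof. by move=> xW; apply/exists_inP; exists x. Qed.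

Lemma component_connect W x : {in component e W x &, forall a b,
  connect (restr e (component e W x)) a b}.
Proof.
move=> a b aC bC.
have: connect (restr e W) a b.
  move: aC bC; rewrite !inE => /andP[_ xa] /andP[_ xb].
  by apply: connect_trans xb; rewrite restr_connect_sym.
case/connectP=> p; elim: p a aC => [|c p IH] a aC /=; first by move=> _ ->.
case/andP=> /and3P[aW cW eac] pth bE.
have cC := component_edge aW cW aC eac.
apply: connect_trans (IH c cC pth bE); apply: connect1.
by rewrite /restr aC cC.
Qed.

(** The subset [S] is left free so that the same component of [W] also splits [W] after
    deletions. *)
Lemma mult_component W S x (C := component e W x) : S \subset W ->
  m S = (m (S :&: C) + m (S :\: C))%N.
Proof.
move=> /subsetP sSW; apply: mult_split => // a b aS bS aC; apply: contra => eab.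
by apply: component_edge eab => //; apply: sSW.
Qed.

Lemma mult_component_del W x u : u \in component e W x ->
  (m W + m (component e W x :\ u) = m (W :\ u) + m (component e W x))%N.
Proof.
set C := component e W x => uC; have sCW := component_sub W x.
rewrite (mult_component x (subxx W)) (mult_component x (subsetDl W [set u])) -/C.
have -> : W :&: C = C by apply/setIidPr.
have -> : (W :\ u) :&: C = C :\ u by rewrite setIDAC; congr (_ :\ _); apply/setIidPr.
have -> : W :\ u :\: C = W :\: C.
  by rewrite setDDl; congr (_ :\: _); apply/setUidPr; rewrite sub1set.
lia.
Qed.

Lemma mult_component_del2 W x u v :
  u \in component e W x -> v \in component e W x ->
  (m W + m (component e W x :\ u :\ v) = m (W :\ u :\ v) + m (component e W x))%N.
Proof.
set C := component e W x => uC vC; have sCW := component_sub W x.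
have sW : W :\ u :\ v \subset W by rewrite setDDl subsetDl.
rewrite (mult_component x (subxx W)) (mult_component x sW) -/C.
have -> : W :&: C = C by apply/setIidPr.
have -> : (W :\ u :\ v) :&: C = C :\ u :\ v.
  by rewrite !setIDAC; congr (_ :\ _ :\ _); apply/setIidPr.
have -> : W :\ u :\ v :\: C = W :\: C.
  rewrite !setDDl setUA; congr (_ :\: _); apply/setUidPr.
  by apply/subsetP=> y /set2P[]->.
lia.
Qed.

(** Deletions on different sides of [C] affect different summands of [m W], so their effects add;
    the form avoids truncated subtraction. *)
Lemma mult_component_sep W x u v :
  u \in component e W x -> v \notin component e W x ->
  (m (W :\ u :\ v) + m W = m (W :\ u) + m (W :\ v))%N.
Proof.
set C := component e W x => uC vC; have sCW := component_sub W x.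
have sW : W :\ u :\ v \subset W by rewrite setDDl subsetDl.
rewrite (mult_component x (subxx W)) (mult_component x sW).
rewrite (mult_component x (subsetDl W [set u])) (mult_component x (subsetDl W [set v])) -/C.
have nv (X : {set T}) : X \subset C -> X :\ v = X.
  move=> /subsetP sX; apply/setP=> y; rewrite in_setD1.
  by case: eqVneq => // ->; apply/esym/negbTE; apply: contra vC => /sX.
have E1 : W :&: C = C by apply/setIidPr.
have E2 (X : {set T}) : (W :\: X) :&: C = C :\: X by rewrite setIDAC E1.
have E3 (X : {set T}) : W :\ u :\: X :\: C = W :\: X :\: C.
  rewrite !setDDl; congr (_ :\: _); apply/setUidPr.
  by rewrite sub1set inE uC orbT.
have E4 : W :\ u :\: C = W :\: C by have := E3 set0; rewrite !setD0.
rewrite E3 E4 E1 [W :\ u :\ v]setDDl !E2 -setDDl (nv C) ?(nv (C :\ u)) ?subsetDl //; lia.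
Qed.

Lemma essential_step W a b : Aset theta e W = set0 -> a \in W -> b \in W ->
  e a b -> (m (W :\ a)).+1 = m W -> (m (W :\ b)).+1 = m W.
Proof.
move=> A0 aW bW eab ma; apply/eqP; apply: contraT => nb.
suff : b \in Aset theta e W by rewrite A0 inE.
by apply/AsetP; split=> //; exists a; rewrite e_sym.
Qed.

Lemma essential_component W x y : Aset theta e W = set0 ->
  (m (W :\ x)).+1 = m W -> y \in component e W x -> (m (W :\ y)).+1 = m W.
Proof.
move=> A0 mx; rewrite inE => /andP[_ /connectP[p pth ->]].
elim: p x mx pth => //= c p IH x mx /andP[/and3P[xW cW exc]].
by apply: IH; apply: essential_step exc mx.
Qed.

Lemma component_critical W x : Aset theta e W = set0 -> x \in W ->
  (m (W :\ x)).+1 = m W -> critical theta e (component e W x).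
Proof.
move=> A0 xW mx; set C := component e W x; apply/and3P; split.
- by apply/set0Pn; exists x; apply: component_refl.
- apply/forall_inP=> a aC; apply/forall_inP=> b bC; exact: component_connect.
apply/forall_inP=> y yC; rewrite /essential yC /=.
have := mult_component_del yC; have := essential_component A0 mx yC.
by rewrite -/C; lia.
Qed.

(** Positive multiplicity would provide an essential vertex in the component, and essentiality would
    spread from it to [x]. *)
Lemma component_mult0 W x : Aset theta e W = set0 -> x \in W ->
  (m (W :\ x)).+1 != m W -> m (component e W x) = 0%N.
Proof.
move=> A0 xW nx; apply/eqP; rewrite -leqn0 leqNgt; apply/negP.
case/(exists_essential e_sym e_irr)=> y yC my; case/negP: nx; apply/eqP.
have yW := subsetP (component_sub W x) y yC.
apply: (@essential_component W y) => //.
  by have := mult_component_del yC; lia.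
move: yC; rewrite !inE => /andP[_ xy]; rewrite xW /=.
by rewrite restr_connect_sym.
Qed.

(** Before each [y] is added the multiplicity is still positive, so there is an essential vertex. It
    is adjacent to [y], which is therefore positive in the larger graph. *)
Lemma mult_join (Z Y : {set T}) : [disjoint Y & Z] ->
  (forall y z, y \in Y -> z != y -> e y z) -> (#|Y| <= m Z)%N ->
  (m (Z :|: Y) + #|Y| = m Z)%N.
Proof.
have [n] := ubnP #|Y|; elim: n Y => // n IH Y leY dYZ univ leYZ.
have [Y0|[y yY]] := set_0Vmem Y; first by rewrite Y0 setU0 cards0 addn0.
have cY : #|Y| = #|Y :\ y|.+1 by rewrite (cardsD1 y) yY.
have yZ : y \notin Z by rewrite (disjointFr dYZ yY).
have := IH (Y :\ y); rewrite cY in leY leYZ *.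
move=> /(_ leY (disjointWl (subsetDl _ _) dYZ)) {}IH.
have {}IH : (m (Z :|: Y :\ y) + #|Y :\ y| = m Z)%N.
  apply: IH; last exact: ltnW.
  by move=> a z /setD1P[_]; apply: univ.
have DS : (Z :|: Y) :\ y = Z :|: Y :\ y.
  apply/setP=> x; rewrite !inE; case: eqVneq => [->|] //=; by rewrite orbF (negPf yZ).
have [|z zF mz] := @exists_essential R T e e_sym e_irr theta (Z :|: Y :\ y).
  by lia.
have nzy : z != y.
  by apply: contraTneq zF => ->; rewrite !inE eqxx /= orbF.
have := @positive_of_essential_nbr R T e e_sym e_irr theta (Z :|: Y) y z.
rewrite DS inE yY orbT => /(_ isT zF (univ _ _ yY nzy) mz); lia.
Qed.

End Components.

(** * Comparison of [S_theta(G)] with [G \ A], and the count over components *)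

Theorem theorem5p9 (R : realFieldType) (T : finType) (e : rel T)
  (e_sym : symmetric e) (e_irr : irreflexive e) (theta : R)
  (Hmult : (2 <= mult theta e [set: T])%N) (u v : T) (huv : u != v) :
  let V := [set: T] in
  let A := Aset theta e V in
  let B := Bset theta e V in
  let N := Nset theta e V in
  let P := Pset theta e V in
  let eS := Srel theta e V in
  let W := V :\: A in
  (* H_i: theta-critical components of G \ A; Q_j: components with mult 0 *)
  let isH := fun C : {set T} => is_component e W C && critical theta e C in
  let isQ := fun C : {set T} => is_component e W C && (mult theta e C == 0)%N in
  mult theta eS (V :\ u :\ v) = mult theta eS V <->
  [\/ ((u \in P :|: A) && (v \in B)) || ((v \in P :|: A) && (u \in B)),
      (u \in N) /\ (v \in N) /\
        exists C1 C2 : {set T}, [/\ isQ C1, isQ C2, C1 != C2, u \in C1 & v \in C2],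
      exists H : {set T}, [/\ isH H, u \in H, v \in H &
                              mult theta e (H :\ u :\ v) = 1%N]
    | exists Q : {set T}, [/\ isQ Q, u \in Q, v \in Q &
                              mult theta e (Q :\ u :\ v) = 0%N]].
Proof.
move=> V A B N P eS W isH isQ.
pose m := mult theta e; set k := mult theta e [set: T] in Hmult.
have [mW A0 mWdel] : [/\ m W = (k + #|A|)%N, Aset theta e W = set0 &
    forall x, x \in W -> m (W :\ x) = (m (V :\ x) + #|A|)%N].
  exact: Aset_structure.
have lo x : (k <= (m (V :\ x)).+1)%N by apply: mult_le_del.
have hi x : (m (V :\ x) <= k.+1)%N by apply: mult_del_le.
have BE x : (x \in B) = ((m (V :\ x)).+1 == k) by rewrite !inE /essential inE.
have NE x : (x \in N) = (m (V :\ x) == k) by rewrite !inE /neutral inE.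
have PE x : (x \in P) = (m (V :\ x) == k.+1) && (x \notin A).
  by rewrite in_set inE /positive inE.
have AE x : x \in A -> m (V :\ x) = k.+1 by apply: Aset_positive.
have WE x : (x \in W) = (x \notin A) by rewrite !in_set andbT.
have subA C x : is_component e W C -> x \in C -> x \notin A.
  by move=> cC /[dup] xC; rewrite (component_id e_sym cC xC) inE WE => /andP[].
have eS_sym : symmetric eS.
  by move=> x y; rewrite /eS /Srel e_sym eq_sym orbC [(x \in _) || _]orbC orbC.
have eS_irr : irreflexive eS by move=> x; rewrite /eS /Srel e_irr eqxx.
(* On [W] the relations [eS] and [e] agree, and the vertices of [A] are universal for [eS], so
   [mult_join] applies. *)
have multS (Z Y : {set T}) : Z \subset W -> Y \subset A -> (#|Y| <= m Z)%N ->
    (mult theta eS (Z :|: Y) + #|Y| = m Z)%N.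
  move=> /subsetP sZ /subsetP sY le.
  have mZ : mult theta eS Z = m Z.
    rewrite /m /mult; congr (mup _ _); apply: eq_match_poly => x y /sZ xW /sZ yW.
    rewrite /eS /Srel -/V -/A; move: xW yW; rewrite !WE => /negPf-> /negPf->.
    by rewrite andbF orbF.
  rewrite -mZ; apply: mult_join => //; last by rewrite mZ.
    rewrite disjoint_subset; apply/subsetP=> x /sY xA; rewrite inE.
    by apply/negP=> /sZ; rewrite WE xA.
  by move=> y z /sY yA nzy; rewrite /eS /Srel -/V -/A yA eq_sym nzy orbT.
have mS : mult theta eS V = k.
  have := @multS W A (subxx _) (subxx _).
  have -> : W :|: A = V by apply/setP=> x; rewrite in_setU WE in_setT orNb.
  by rewrite mW leq_addl => /(_ isT); apply: addIn.
(* [Hmult] enters here: [m (W :\ u :\ v) >= k + #|A| - 2 >= #|A|], enough to join the rest of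
   [A]. *)
have mSuv : (mult theta eS (V :\ u :\ v) + #|A :\ u :\ v| = m (W :\ u :\ v))%N.
  have -> : V :\ u :\ v = W :\ u :\ v :|: A :\ u :\ v.
    by rewrite -!setDUl; congr (_ :\ _ :\ _); apply/setP=> x; rewrite [RHS]in_setU WE in_setT orNb.
  have sub2 (X : {set T}) : X :\ u :\ v \subset X by rewrite setDDl subsetDl.
  apply: multS => //; have := subset_leq_card (sub2 A).
  have := mult_le_del e_sym e_irr theta W u.
  have := mult_le_del e_sym e_irr theta (W :\ u) v.
  by rewrite -/m; move: mW Hmult; clear; lia.
have delW x : x \in A -> W :\ x = W.
  by move=> xA; apply/setP=> y; rewrite in_setD1 WE; case: eqVneq => // ->; rewrite xA.
have delA x : x \notin A -> A :\ x = A.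
  by move=> xA; apply/setP=> y; rewrite in_setD1; case: eqVneq => // ->; apply/esym/negbTE.
have cardA x : x \in A -> #|A| = #|A :\ x|.+1 by move=> xA; rewrite (cardsD1 x) xA.
have memPA x : (x \in P :|: A) = (m (V :\ x) == k.+1).
  rewrite in_setU PE; case xA: (x \in A); first by rewrite orbT AE ?eqxx.
  by rewrite orbF andbT.
rewrite mS !memPA !BE !NE.
have [uA|uA] := boolP (u \in A).
  have mu := AE u uA.
  have R234 : (forall C, is_component e W C -> u \in C -> False).
    by move=> C cC /(subA C u cC); rewrite uA.
  have cA := cardA u uA.
  have [vA|vA] := boolP (v \in A).
    (* Deleting two special vertices gives multiplicity [k + 2], and none of the four cases allows
       such a pair. *)
    have mv := AE v vA; split.
      have cA2 : #|A :\ u| = #|A :\ u :\ v|.+1.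
        by rewrite (cardsD1 v) in_setD1 vA eq_sym huv.
      rewrite !delW // in mSuv; move: mSuv mW cA cA2; clear; lia.
    case=> [|[/eqP]|[C [/andP[cC _] uC _ _]]|[C [/andP[cC _] uC _ _]]].
    - by move: mu mv; clear; lia.
    - by move: mu; clear; lia.
    - by case: (R234 C cC uC).
    - by case: (R234 C cC uC).
  (* Only [v] leaves [W], so the multiplicity becomes [m (V :\ v) + 1], which is [k] exactly when
     [v] is essential. *)
  have mWv := mWdel v; rewrite WE vA in mWv.
  have {}mWv := mWv isT.
  have vAu : A :\ u :\ v = A :\ u by rewrite setD1C (delA v).
  rewrite delW // vAu in mSuv.
  split=> [E|].
    by apply: Or41; move: mSuv E mW cA mWv mu; clear; lia.
  case=> [|[/eqP]|[C [/andP[cC _] uC _ _]]|[C [/andP[cC _] uC _ _]]].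
  - by move: mSuv mW cA mWv mu; clear; lia.
  - by move: mu; clear; lia.
  - by case: (R234 C cC uC).
  - by case: (R234 C cC uC).
have mWu := mWdel u; rewrite WE uA in mWu; have {}mWu := mWu isT.
have [vA|vA] := boolP (v \in A).
  have mv := AE v vA.
  have R234 : (forall C, is_component e W C -> v \in C -> False).
    by move=> C cC /(subA C v cC); rewrite vA.
  have cA := cardA v vA.
  rewrite (setD1C W) (delW v) // (delA u) // in mSuv.
  split=> [E|].
    by apply: Or41; move: mSuv E mW cA mWu mv; clear; lia.
  case=> [|[_ [/eqP]]|[C [/andP[cC _] _ vC _]]|[C [/andP[cC _] _ vC _]]].
  - by move: mSuv mW cA mWu mv; clear; lia.
  - by move: mv; clear; lia.
  - by case: (R234 C cC vC).
  - by case: (R234 C cC vC).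
have mWv := mWdel v; rewrite WE vA in mWv; have {}mWv := mWv isT.
(* All of [A] survives, so the question is whether [m (W :\ u :\ v) = m W]. *)
rewrite !delA // in mSuv.
have uW : u \in W by rewrite WE.
have vW : v \in W by rewrite WE.
set C := component e W u.
have cC : is_component e W C by apply: component_is_component.
have uC : u \in C by apply: component_refl.
have critE D : critical theta e D -> m D = 1%N by apply: critical_mult.
have [vC|vC] := boolP (v \in C).
  have mC := mult_component_del2 e_sym e_irr theta uC vC.
  rewrite -/C -/m in mC.
  (* Essentiality is constant on a component of [W], which rules out case (a) here. *)
  have essuv : ((m (V :\ u)).+1 == k) = ((m (V :\ v)).+1 == k).
    have vCu : u \in component e W v by rewrite -(component_id e_sym cC vC).
    have := @essential_component _ _ _ e_sym theta W u v A0.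
    have := @essential_component _ _ _ e_sym theta W v u A0.
    rewrite -/m => /(_ _ vCu) H1 /(_ _ vC) H2.
    apply/idP/idP=> H.
      by move: H1 H2 H mW mWu mWv; clear; lia.
    by move: H1 H2 H mW mWu mWv; clear; lia.
  split=> [E|].
    have [eu|nu] := boolP ((m (V :\ u)).+1 == k).
      have crit : critical theta e C.
        apply: component_critical => //.
        by rewrite -/m; move: eu mW mWu; clear; lia.
      apply: Or43; exists C; rewrite /isH cC crit; split=> //.
      by move: (critE C crit) mC E mSuv mW; rewrite /m; clear; lia.
    have m0 : m C = 0%N.
      apply: component_mult0 => //.
      by rewrite -/m; move: nu mW mWu; clear; lia.
    apply: Or44; exists C; rewrite /isQ cC -/m m0 eqxx; split=> //.
    by move: m0 mC E mSuv mW; clear; lia.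
  case=> [|[_ [_ [C1 [C2 [/andP[c1 _] /andP[c2 _] n12 u1 v2]]]]]
          |[D [/andP[cD crit] uD vD mD]]|[D [/andP[cD /eqP mD0] uD vD mD]]].
  - by move: essuv; clear; lia.
  - case/eqP: n12; rewrite (component_id e_sym c1 u1) (component_id e_sym c2 v2).
    by rewrite -(component_id e_sym cC vC).
  - have DC : D = C by rewrite (component_id e_sym cD uD).
    move: (critE D crit) mD mC mSuv mW; rewrite DC -/m; clear; lia.
  - have DC : D = C by rewrite (component_id e_sym cD uD).
    move: mD0 mD mC mSuv mW; rewrite DC -/m; clear; lia.
have mC := mult_component_sep e_sym e_irr theta uC vC; rewrite -/m in mC.
split=> [E|].
  (* The changes caused by [u] and [v] add up to zero: either they are [-1] and [+1], which is case
     (a), or both vanish, which is case (b). *)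
  have [eu|nu] := boolP ((m (V :\ u)).+1 == k).
    by apply: Or41; move: eu mC E mSuv mW mWu mWv; clear; lia.
  have [ev|nv] := boolP ((m (V :\ v)).+1 == k).
    by apply: Or41; move: ev mC E mSuv mW mWu mWv; clear; lia.
  apply: Or42; split; [|split].
  - by move: (lo u) (lo v) nu nv mC E mSuv mW mWu mWv; clear; lia.
  - by move: (lo u) (lo v) nu nv mC E mSuv mW mWu mWv; clear; lia.
  exists C, (component e W v); split.
  - rewrite /isQ cC; apply/eqP; apply: component_mult0 => //.
    by rewrite -/m; move: nu mW mWu; clear; lia.
  - rewrite /isQ component_is_component //; apply/eqP; apply: component_mult0 => //.
    by rewrite -/m; move: nv mW mWv; clear; lia.
  - by apply: contraNneq vC => ->; apply: component_refl.
  - by [].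
  - exact: component_refl.
case=> [|[/eqP mu [/eqP mv _]]
        |[D [/andP[cD _] uD vD _]]|[D [/andP[cD _] uD vD _]]].
- by move: mC mSuv mW mWu mWv; clear; lia.
- by move: mu mv mC mSuv mW mWu mWv; clear; lia.
- by case/negP: vC; rewrite /C -(component_id e_sym cD uD).
- by case/negP: vC; rewrite /C -(component_id e_sym cD uD).
Qed.
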